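(* Let $J(\Gamma)=\sum_{k=0}^{N}a(k)K_\Gamma(k)$, where $K_\Gamma(k)$, $0\le k\le N$, is given by the state equation $$K_\Gamma(k)=H_\Gamma(k-1,0)^2\,\mathbb V(x_0)+\sum_{i=0}^{k-1}H_\Gamma(k-1,i+1)^2\big[\sigma(i)^2+\Gamma(i)^2\gamma(i)^2\big]+2\sum_{i=0}^{k-1}\sum_{j=0}^{i-1}\rho_1(i-j)\sigma(i)\sigma(j)H_\Gamma(k-1,i+1)H_\Gamma(k-1,j+1)$$ $$\qquad+2\sum_{i=0}^{k-1}\sum_{j=0}^{i-1}\rho_2(i-j)\Gamma(i)\Gamma(j)\gamma(i)\gamma(j)H_\Gamma(k-1,i+1)H_\Gamma(k-1,j+1).$$ Assume that $\Gamma_0=(\Gamma_0(0),\dots,\Gamma_0(N-1))$ is the optimal control for this control problem, i.e. $J(\Gamma_0)\le J(\Gamma)$ for all $\Gamma\in\mathbb R^N$. Then the following system of equations holds (for $1\le k\le N$ and $0\le i\le k-1$ in the formulas for $Q_1,Q_2,Q_3,Q$): $$H_{\Gamma_0}(k)=A(k)-\Gamma_0(k)D(k)\quad(0\le k\le N-1),\qquad H_{\Gamma_0}(k-1,i)=\prod_{j=i}^{k-1}H_{\Gamma_0}(j),$$ $$Q_1(k-1,i)=-2H_{\Gamma_0}(k-1,0)\,\mathbb V(x_0)\,H_{\Gamma_0}(i-1,0)H_{\Gamma_0}(k-1,i+1),$$ $$Q_2(k-1,i)=\sum_{j=0}^{k-1}\rho_2(i-j)\Gamma_0(j)\gamma(i)\gamma(j)H_{\Gamma_0}(k-1,i+1)H_{\Gamma_0}(k-1,j+1),$$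 $$Q_3(k-1,i)=-\sum_{l=0}^{i-1}\sum_{j=0}^{k-1}\big[\rho_1(l-j)\sigma(l)\sigma(j)+\rho_2(l-j)\Gamma_0(l)\Gamma_0(j)\gamma(l)\gamma(j)\big]H_{\Gamma_0}(k-1,j+1)H_{\Gamma_0}(i-1,l+1)H_{\Gamma_0}(k-1,i+1)D(i),$$ $$Q=Q_1+Q_2+Q_3,$$ $$\sum_{k=i+1}^{N}a(k)\,Q(k-1,i)=0,\qquad i=0,1,\dots,N-1.$$ At the same time, the optimal filter is given by $$z_0(k+1)=\big(A(k)-\Gamma_0(k)D(k)\big)z_0(k)+\big(C(k)-\Gamma_0(k)F(k)\big)y(k)+\Gamma_0(k)y(k+1),\quad 0\le k\le N-1,\qquad z_0(0)=\mathbb E x_0.$$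
   Context: Fix an integer $N\ge1$ and real sequences $A(k),C(k),\sigma(k),D(k),F(k),\gamma(k)$, $0\le k\le N-1$, and a given non-negative weight sequence $a(k)$, $0\le k\le N$. Let $H_1,H_2\in(1/2,1)$ and let $B^{H_1},\tilde B^{H_2}$ be independent real-valued fractional Brownian motions with Hurst parameters $H_1,H_2$ (continuous mean-zero Gaussian processes with covariance $\mathbb E[B^{H}(t)B^{H}(s)]=\frac12(t^{2H}+s^{2H}-|t-s|^{2H})$). Put $W_1(k)=B^{H_1}(k+1)-B^{H_1}(k)$ and $W_2(k)=\tilde B^{H_2}(k+1)-\tilde B^{H_2}(k)$. Let $x_0$ be a real random variable with finite variance $\mathbb V(x_0)$, independent of the noises. The (scalar) signal/observation system is, for $0\le k\le N-1$, $$x(k+1)=A(k)x(k)+C(k)y(k)+\sigma(k)W_1(k),\quad y(k+1)=D(k)x(k)+F(k)y(k)+\gamma(k)W_2(k),\quad x(0)=x_0,\ y(0)=0.$$ For integers $k$ and $l=1,2$, $\rho_l(k)=\mathbb E[W_l(i)W_l(i+k)]=\frac12\big(|k+1|^{2H_l}+|k-1|^{2H_l}-2|k|^{2H_l}\big)$ (independent of $i$). For $\Gamma=(\Gamma(0),\dots,\Gamma(N-1))\in\mathbb R^N$ put $H_\Gamma(k)=A(k)-\Gamma(k)D(k)$, $M_\Gamma(k)=C(k)-\Gamma(k)F(k)$, and for $0\le i\le k\le N$ put $H_\Gamma(k-1,i)=\prod_{j=i}^{k-1}H_\Gamma(j)$, with the empty product convention $H_\Gamma(i-1,i)=1$. Empty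 sums are $0$. The filter associated with $\Gamma$ is the process $z_\Gamma$ defined by $$z_\Gamma(k+1)=H_\Gamma(k)z_\Gamma(k)+M_\Gamma(k)y(k)+\Gamma(k)y(k+1),\quad 0\le k\le N-1,\qquad z_\Gamma(0)=\mathbb E x_0.$$ The quantity $K_\Gamma(k)$ of the state equation is the error covariance $\mathbb E[(x(k)-z_\Gamma(k))^2]$. The optimal filter means the one minimizing $\sum_{k=0}^N a(k)\,\mathbb E|x(k)-z_\Gamma(k)|^2$ among the filters $z_\Gamma$, $\Gamma\in\mathbb R^N$.
   Formalization: The prefactor −2 in Q_1(k−1,i) is replaced by −D(i), the correct half-derivative; as printed the system fails, e.g. for N=1, A=γ=a(1)=V(x_0)=1, D=0, where Γ_0(0)=0 but the equation reads −2=0. *)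

(* Defs.v *)
From HB Require Import structures.
From mathcomp Require Import all_boot all_order all_algebra.
From mathcomp Require Import all_classical all_reals all_analysis.
Set Implicit Arguments.
Unset Strict Implicit.
Unset Printing Implicit Defensive.
Import Order.TTheory GRing.Theory Num.Theory.
Import numFieldNormedType.Exports.
Local Open Scope classical_set_scope.
Local Open Scope ring_scope.

Section probability_notions.
Context {d : measure_display} {T : measurableType d} {R : realType}.
Variable P : probability T R.

(* The degenerate law is a separate case because the library's
   [normal_prob m 0] is the uniform law on [0, 1], not a Dirac mass. *)
Definition gaussian_rv (X : T -> R) : Prop :=
  (exists m : R, {ae P, forall w, X w = m}) \/
  (exists m s : R, 0 < s /\
    forall S : set R, measurable S -> P (X @^-1` S) = normal_prob m s S).

(* Processes on [0, +oo[ are indexed by all of [R]; nothing is required of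
   the values at negative times. *)
Definition gaussian_process (B : R -> {RV P >-> R}) : Prop :=
  forall (n : nat) (t c : 'I_n -> R), (forall i, 0 <= t i) ->
    gaussian_rv (fun w => \sum_(i < n) c i * B (t i) w).

Definition is_fbm (H : R) (B : R -> {RV P >-> R}) : Prop :=
  [/\ gaussian_process B,
      {ae P, forall w, {within `[0, +oo[, continuous (fun t : R => B t w)}},
      (forall t, 0 <= t -> 'E_P[B t]%E = 0%E) &
      forall s t, 0 <= s -> 0 <= t ->
        'E_P[fun w => (B t w * B s w)%R]%E =
        (2^-1 * (t `^ (2 * H) + s `^ (2 * H) - `|t - s| `^ (2 * H)))%:E].

Definition sigma_family (I : Type) (D : set I) (X : I -> T -> R) :
    set_system T :=
  <<s \bigcup_(i in D)
        preimage_set_system [set: T] (X i) (@measurable _ R) >>.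

Definition indep_sigma (F G : set_system T) : Prop :=
  forall S U : set T, F S -> G U -> P (S `&` U) = (P S * P U)%E.

Definition indep_processes (B B' : R -> {RV P >-> R}) : Prop :=
  indep_sigma (sigma_family [set t | 0 <= t] B)
              (sigma_family [set t | 0 <= t] B').

Definition increment (B : R -> {RV P >-> R}) (k : nat) (w : T) : R :=
  B (k.+1)%:R w - B k%:R w.

Definition indep_of_noises (x0 : T -> R) (W1 W2 : nat -> T -> R) : Prop :=
  indep_sigma (sigma_family [set: unit] (fun=> x0))
              <<s sigma_family [set: nat] W1 `|` sigma_family [set: nat] W2 >>.

End probability_notions.

Section system.
Context {T : Type} {R : realType}.
Variables (N : nat) (A C sigma D F gamma : nat -> R).

Definition signal_observation (W1 W2 : nat -> T -> R) (x0 : T -> R)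
    (x y : nat -> T -> R) : Prop :=
  [/\ forall k, (k < N)%N -> forall w,
        x k.+1 w = A k * x k w + C k * y k w + sigma k * W1 k w,
      forall k, (k < N)%N -> forall w,
        y k.+1 w = D k * x k w + F k * y k w + gamma k * W2 k w,
      forall w, x 0%N w = x0 w &
      forall w, y 0%N w = 0].

(* [G] stands for Gamma; [m0] is the mean of the initial state. *)
Definition is_filter (m0 : R) (y : nat -> T -> R) (G : nat -> R)
    (z : nat -> T -> R) : Prop :=
  (forall k, (k < N)%N -> forall w,
     z k.+1 w = (A k - G k * D k) * z k w + (C k - G k * F k) * y k w
                + G k * y k.+1 w) /\
  (forall w, z 0%N w = m0).

End system.

(* The sequence of entries of a control in R^N, extended by 0 beyond N - 1;
   only the indices k < N are ever used. *)
Definition ctl {R : realType} {N : nat} (G : 'rV[R]_N) (k : nat) : R :=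
  if insub k is Some i then G 0 i else 0.

Section optimality.
Context {d : measure_display} {T : measurableType d} {R : realType}.
Variable P : probability T R.
Variables (N : nat) (A C D F a : nat -> R).

Definition mse_cost (x z : nat -> T -> R) : \bar R :=
  (\sum_(0 <= k < N.+1)
     (a k)%:E * 'E_P[fun w => (`|x k w - z k w| ^+ 2)%R])%E.

Definition optimal_filter (m0 : R) (x y z : nat -> T -> R) : Prop :=
  (exists G : 'rV[R]_N, is_filter N A C D F m0 y (ctl G) z) /\
  (forall (G : 'rV[R]_N) (z' : nat -> T -> R),
     is_filter N A C D F m0 y (ctl G) z' -> (mse_cost x z <= mse_cost x z')%E).

End optimality.

Section control_problem.
Context {R : realType}.
Variables (A D sigma gamma : nat -> R) (H1 H2 V : R).
(* [V] is the variance of the initial state. *)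

Definition rho (H : R) (k : int) : R :=
  2^-1 * (`|(k + 1)%:~R| `^ (2 * H) + `|(k - 1)%:~R| `^ (2 * H)
          - 2 * `|k%:~R| `^ (2 * H)).

Definition Hcoef (G : nat -> R) (k : nat) : R := A k - G k * D k.

(* [Hprod G k i] is H_G(k-1,i), and [Q1 G k i], [Q2 G k i], [Q3 G k i],
   [Q G k i] are Q_1(k-1,i), Q_2(k-1,i), Q_3(k-1,i), Q(k-1,i): the first
   argument is shifted by one, so that k = 0 makes sense in [nat]. *)
Definition Hprod (G : nat -> R) (k i : nat) : R :=
  \prod_(i <= j < k) Hcoef G j.

Definition Kstate (G : nat -> R) (k : nat) : R :=
  Hprod G k 0 ^+ 2 * V
  + \sum_(0 <= i < k)
      Hprod G k i.+1 ^+ 2 * (sigma i ^+ 2 + G i ^+ 2 * gamma i ^+ 2)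
  + 2 * (\sum_(0 <= i < k) \sum_(0 <= j < i)
      rho H1 (i%:Z - j%:Z) * sigma i * sigma j
        * Hprod G k i.+1 * Hprod G k j.+1)
  + 2 * (\sum_(0 <= i < k) \sum_(0 <= j < i)
      rho H2 (i%:Z - j%:Z) * G i * G j * gamma i * gamma j
        * Hprod G k i.+1 * Hprod G k j.+1).

Definition Jcost (N : nat) (a : nat -> R) (G : nat -> R) : R :=
  \sum_(0 <= k < N.+1) a k * Kstate G k.

(* Q1 + Q2 + Q3 is half the partial derivative of [Kstate G k] in [G i], with
   Q1 coming from the first summand.  The source prints the prefactor of Q1 as
   -2, without D(i), instead of -D(i).  The printed equations fail already for
   N = 1, A = gamma = V = a(1) = 1, D = 0: the minimizer is G(0) = 0, where
   the printed Q(0,0) is -2. *)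
Definition Q1 (G : nat -> R) (k i : nat) : R :=
  - (Hprod G k 0 * V * Hprod G i 0 * Hprod G k i.+1 * D i).

Definition Q2 (G : nat -> R) (k i : nat) : R :=
  \sum_(0 <= j < k)
    rho H2 (i%:Z - j%:Z) * G j * gamma i * gamma j
      * Hprod G k i.+1 * Hprod G k j.+1.

Definition Q3 (G : nat -> R) (k i : nat) : R :=
  - \sum_(0 <= l < i) \sum_(0 <= j < k)
      (rho H1 (l%:Z - j%:Z) * sigma l * sigma j
       + rho H2 (l%:Z - j%:Z) * G l * G j * gamma l * gamma j)
      * Hprod G k j.+1 * Hprod G i l.+1 * Hprod G k i.+1 * D i.

Definition Q (G : nat -> R) (k i : nat) : R := Q1 G k i + Q2 G k i + Q3 G k i.

End control_problem.

(* Main.v *)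
(* The error e = x - z_Gamma obeys e(k+1) = H_Gamma(k) e(k) + sigma(k) W_1(k)
   - Gamma(k) gamma(k) W_2(k), since the observation terms cancel.  Unrolled,
   it is a combination of x_0 - E x_0, the W_1(i) and the W_2(i), three
   mutually orthogonal families in L^2, so E e(k)^2 = K_Gamma(k) and the
   filtering cost of z_Gamma is J(Gamma).
   Each coefficient of e(k) is affine in a single entry Gamma(i), so
   t |-> K_{Gamma + t e_i}(k) is a quadratic polynomial, whose linear
   coefficient is 2 Q(k-1,i) for k > i and 0 otherwise.  Minimality of
   Gamma_0 forces the linear coefficient of J to vanish. *)
Require Import Defs.
From HB Require Import structures.
From mathcomp Require Import all_boot all_order all_algebra.
From mathcomp Require Import all_classical all_reals all_analysis.
From mathcomp Require Import measurable_realfun ring lra.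
Set Implicit Arguments.
Unset Strict Implicit.
Unset Printing Implicit Defensive.
Import Order.TTheory GRing.Theory Num.Theory.
Import numFieldNormedType.Exports.
Local Open Scope classical_set_scope.
Local Open Scope ring_scope.

(** * Symmetric quadratic forms and the first-order condition for a quadratic polynomial *)

Section quadratic_forms.
Context {R : realType}.
Implicit Types (r : nat -> nat -> R) (u v du : nat -> R).

Definition qform r k u v : R :=
  \sum_(0 <= i < k) \sum_(0 <= j < k) r i j * u i * v j.

Lemma sum_square_sym k (f : nat -> nat -> R) : (forall i j, f i j = f j i) ->
  \sum_(0 <= i < k) \sum_(0 <= j < k) f i j =
  \sum_(0 <= i < k) f i i + 2 * \sum_(0 <= i < k) \sum_(0 <= j < i) f i j.
Proof.
move=> fC; elim: k => [|k IH]; first by rewrite !big_nil mulr0 addr0.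
rewrite !(big_nat_recr k)//=.
under eq_bigr do rewrite (big_nat_recr k)//=.
rewrite big_split/= IH (eq_bigr (fun j => f k j)) => [|j _]; last exact: fC.
ring.
Qed.

(** Symmetry folds the two triangles into the factor 2 and the unit diagonal leaves plain squares,
    which is the shape of the sums in [Kstate]. *)
Lemma qform_diag r k u : (forall i j, r i j = r j i) -> (forall i, r i i = 1) ->
  qform r k u u = \sum_(0 <= i < k) u i ^+ 2
    + 2 * \sum_(0 <= i < k) \sum_(0 <= j < i) r i j * u i * u j.
Proof.
move=> rC r1; rewrite /qform sum_square_sym => [|i j]; last first.
  by rewrite rC mulrAC.
by congr (_ + _); apply: eq_bigr => i _; rewrite r1 mul1r expr2.
Qed.

Lemma eq_qform r k u u' : (forall l, (l < k)%N -> u l = u' l) ->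
  qform r k u u = qform r k u' u'.
Proof.
move=> uu'; apply: eq_big_nat => i /= ik; apply: eq_big_nat => j /= jk.
by rewrite !uu'.
Qed.

Lemma qformC r k u v : (forall i j, r i j = r j i) ->
  qform r k u v = qform r k v u.
Proof.
move=> rC; rewrite /qform exchange_big; apply: eq_bigr => i _.
by apply: eq_bigr => j _; rewrite rC mulrAC.
Qed.

Lemma qform_shift r k u du t : (forall i j, r i j = r j i) ->
  qform r k (fun l => u l + t * du l) (fun l => u l + t * du l) =
  qform r k u u + 2 * t * qform r k du u + t ^+ 2 * qform r k du du.
Proof.
move=> rC.
(* Splitting the cross term into its two mirror images makes the identity hold summand by
   summand. *)
have -> : 2 * t * qform r k du u = t * qform r k du u + t * qform r k u du.
  by rewrite (qformC _ u du)//; ring.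
rewrite /qform !big_distrr/= -!big_split/=; apply: eq_bigr => i _.
rewrite !big_distrr/= -!big_split/=; apply: eq_bigr => j _.
ring.
Qed.

(** The sign of [c] is unknown, so the vertex -s/c may not exist. With b = |c| + 1, the point t =
    -s/b gives the value -s^2 (2b - c)/b^2, where 2b - c > 0; hence s^2 <= 0. *)
Lemma linear_coef_eq0 (s c : R) :
  (forall t, 0 <= 2 * t * s + t ^+ 2 * c) -> s = 0.
Proof.
move=> h; apply/eqP; rewrite -sqrf_eq0 eq_le sqr_ge0 andbT.
have b0 : 0 < `|c| + 1 by rewrite ltr_wpDl.
have := h (- s / (`|c| + 1)).
set b := `|c| + 1 in b0 *.
have -> : 2 * (- s / b) * s + (- s / b) ^+ 2 * c =
    - (s ^+ 2 * (2 * b - c)) / b ^+ 2.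
  by field; rewrite gt_eqF.
rewrite pmulr_lge0 ?invr_gt0 ?exprn_gt0// oppr_ge0 pmulr_lle0//.
by have := ler_norm c; have := normr_ge0 c; rewrite /b; lra.
Qed.

End quadratic_forms.

(** * Symmetry and normalization of the increment covariance *)

Section rho.
Context {R : realType}.
Implicit Type H : R.

(** The last term of [rho] is a power of 0, which vanishes only for a nonzero exponent: [powR] gives
    1 at exponent 0. *)
Lemma rho0 H : H != 0 -> rho H 0 = 1.
Proof.
move=> H0; rewrite /rho add0r sub0r normr0 powR0 ?mulf_neq0// mulr0 subr0.
by rewrite mulrNz normrN normr1 powR1; field.
Qed.

Lemma rhoN H (k : int) : rho H (- k) = rho H k.
Proof.
rewrite /rho -(opprB 1 k) -(opprD k 1) [- k + 1]addrC !mulrNz !normrN.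
by rewrite -opprB mulrNz normrN [X in 2^-1 * (X - _)]addrC.
Qed.

Lemma rho_distC H (i j : nat) :
  rho H (i%:Z - j%:Z) = rho H (j%:Z - i%:Z).
Proof. by rewrite -rhoN opprB. Qed.

End rho.

(** * Dependence of the state equation and of the cost on a single entry of the control *)

Section state_equation.
Context {R : realType}.
Variables (A D sigma gamma : nat -> R) (H1 H2 V : R).
Hypotheses (H1_neq0 : H1 != 0) (H2_neq0 : H2 != 0).
Implicit Type G : nat -> R.

Local Notation Hprod := (Hprod A D).
Local Notation r1 := (fun i j : nat => rho H1 (i%:Z - j%:Z)).
Local Notation r2 := (fun i j : nat => rho H2 (i%:Z - j%:Z)).

(** The coefficients of W_1(l) and, up to sign, of W_2(l) in the error at time [k]. The sign is
    dropped because [obs_coef] enters the error covariance quadratically. *)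
Definition signal_coef G k l : R := Hprod G k l.+1 * sigma l.
Definition obs_coef G k l : R := Hprod G k l.+1 * (G l * gamma l).

(** Since [rho] is 1 at lag 0, the squares in the state equation are the diagonals of two full
    double sums. *)
Lemma Kstate_qform G k : Kstate A D sigma gamma H1 H2 V G k =
  Hprod G k 0 ^+ 2 * V + qform r1 k (signal_coef G k) (signal_coef G k)
  + qform r2 k (obs_coef G k) (obs_coef G k).
Proof.
rewrite !qform_diag; try by move=> i *; rewrite ?subrr ?rho0 1?rho_distC.
rewrite /Kstate -!addrA; congr (_ + _).
rewrite !addrA [X in _ = X + _]addrAC -big_split/= -!addrA; congr (_ + _).
  by apply: eq_bigr => i _; rewrite /signal_coef /obs_coef; ring.
by congr (2 * _ + 2 * _); apply: eq_bigr => i _; apply: eq_bigr => j _;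
  rewrite /signal_coef /obs_coef /=; ring.
Qed.

Definition shift_ctl G i t : nat -> R := fun j => G j + (j == i)%:R * t.

Lemma Hprod_recr G k l : (l <= k)%N ->
  Hprod G k.+1 l = Hprod G k l * Hcoef A D G k.
Proof. by move=> lk; rewrite /Hprod big_nat_recr. Qed.

Lemma Hprod_id G k : Hprod G k k = 1.
Proof. by rewrite /Hprod big_geq. Qed.

Lemma Hprod_split G i k l : (l <= i)%N -> (i < k)%N ->
  Hprod G k l = Hprod G i l * Hcoef A D G i * Hprod G k i.+1.
Proof.
move=> li ik; rewrite /Hprod (big_cat_nat (n := i.+1))//=; last exact: leqW.
by rewrite big_nat_recr.
Qed.

Lemma Hprod_shift_notin G i t k l : (k <= i)%N || (i < l)%N ->
  Hprod (shift_ctl G i t) k l = Hprod G k l.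
Proof.
move=> h; apply: eq_big_nat => j /andP[lj jk]; rewrite /Hcoef /shift_ctl.
have -> : (j == i) = false.
  apply/eqP => ji; subst j; case/orP: h; first by rewrite leqNgt jk.
  by rewrite ltnNge lj.
by rewrite mul0r addr0.
Qed.

(** Exactly one factor of the product, [Hcoef A D G i], contains [G i], and it does so with slope
    [- D i]. *)
Lemma Hprod_shift_in G i t k l : (l <= i)%N -> (i < k)%N ->
  Hprod (shift_ctl G i t) k l
  = Hprod G k l + t * (- (D i * Hprod G i l * Hprod G k i.+1)).
Proof.
move=> li ik; rewrite !(Hprod_split _ li ik).
rewrite !Hprod_shift_notin ?leqnn ?ltnSn ?orbT// /Hcoef /shift_ctl eqxx mul1r.
ring.
Qed.

(* [dsignal_coef] and [dobs_coef] are the derivatives of [signal_coef G k l]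
   and [obs_coef G k l] in [G i], for i < k. *)
Definition dsignal_coef G i k l : R :=
  if (l < i)%N then - (D i * Hprod G i l.+1 * Hprod G k i.+1) * sigma l else 0.

Definition dobs_coef G i k l : R :=
  if (l < i)%N then - (D i * Hprod G i l.+1 * Hprod G k i.+1) * (G l * gamma l)
  else if l == i then Hprod G k i.+1 * gamma i else 0.

Lemma signal_coef_shift G i t k l : (i < k)%N -> (l < k)%N ->
  signal_coef (shift_ctl G i t) k l
  = signal_coef G k l + t * dsignal_coef G i k l.
Proof.
move=> ik lk; rewrite /signal_coef /dsignal_coef.
have [li|il] := ltnP l i; first by rewrite Hprod_shift_in//; ring.
by rewrite Hprod_shift_notin ?ltnS ?il ?orbT// mulr0 addr0.
Qed.

(** Entry [i] occurs in the product only for l < i and as the explicit factor [G l] only for l = i.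
    The two cases exclude each other, so no term in t^2 arises. *)
Lemma obs_coef_shift G i t k l : (i < k)%N -> (l < k)%N ->
  obs_coef (shift_ctl G i t) k l = obs_coef G k l + t * dobs_coef G i k l.
Proof.
move=> ik lk; rewrite /obs_coef /dobs_coef.
have [li|il] := ltnP l i.
  by rewrite Hprod_shift_in// /shift_ctl ltn_eqF// mul0r addr0; ring.
rewrite Hprod_shift_notin ?ltnS ?il ?orbT// /shift_ctl.
by case: eqVneq => [->|_] /=; rewrite ?mul1r ?mul0r; ring.
Qed.

Lemma qform_support (r : nat -> nat -> R) i k du u : (i <= k)%N ->
  (forall l, (i <= l)%N -> du l = 0) ->
  qform r k du u = \sum_(0 <= l < i) \sum_(0 <= j < k) r l j * du l * u j.
Proof.
move=> ik du0; rewrite /qform (big_cat_nat (n := i))//=.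
rewrite [X in _ + X]big1_seq ?addr0// => l /andP[_].
rewrite mem_index_iota => /andP[il _].
by rewrite big1// => j _; rewrite du0// mulr0 mul0r.
Qed.

(** Polarized form of [Kstate_qform]: each square is replaced by the product of a coefficient with
    its derivative in [G i], which is half the derivative of the square. *)
Lemma Q_qform G i k : (i < k)%N -> Q A D sigma gamma H1 H2 V G k i =
  Hprod G k 0 * (- (D i * Hprod G i 0 * Hprod G k i.+1)) * V
  + qform r1 k (dsignal_coef G i k) (signal_coef G k)
  + qform r2 k (dobs_coef G i k) (obs_coef G k).
Proof.
move=> ik; rewrite /Q -!addrA; congr (_ + _); first by rewrite /Q1; ring.
rewrite (@qform_support _ i) 1?ltnW//; last first.
  by move=> l il; rewrite /dsignal_coef ltnNge il.
rewrite (@qform_support _ i.+1)//; last first.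
  by move=> l il; rewrite /dobs_coef ltnNge ltnW//= gtn_eqF.
(* Row [l = i] of the observation form is [Q2]; its rows [l < i], merged with those of the signal
   form, make up [Q3]. *)
rewrite big_nat_recr//= addrA -big_split/= addrC; congr (_ + _).
  rewrite /Q3 -sumrN; apply: eq_big_nat => l /= li.
  rewrite -sumrN -big_split; apply: eq_bigr => j _.
  by rewrite /dsignal_coef /dobs_coef li /signal_coef /obs_coef /=; ring.
rewrite /Q2; apply: eq_bigr => j _.
rewrite /dobs_coef ltnn eqxx /obs_coef /=; ring.
Qed.

Lemma Kstate_shift_notin G i t k : (k <= i)%N ->
  Kstate A D sigma gamma H1 H2 V (shift_ctl G i t) k
  = Kstate A D sigma gamma H1 H2 V G k.
Proof.
move=> ki; rewrite !Kstate_qform.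
congr (_ ^+ 2 * _ + _ + _); first by rewrite Hprod_shift_notin ?ki.
  by apply: eq_qform => l lk; rewrite /signal_coef Hprod_shift_notin ?ki.
apply: eq_qform => l lk; rewrite /obs_coef Hprod_shift_notin ?ki// /shift_ctl.
by rewrite ltn_eqF ?mul0r ?addr0// (leq_trans lk).
Qed.

Definition Kstate_coef2 G i k : R :=
  (D i * Hprod G i 0 * Hprod G k i.+1) ^+ 2 * V
  + qform r1 k (dsignal_coef G i k) (dsignal_coef G i k)
  + qform r2 k (dobs_coef G i k) (dobs_coef G i k).

Lemma Kstate_shift_in G i t k : (i < k)%N ->
  Kstate A D sigma gamma H1 H2 V (shift_ctl G i t) k
  = Kstate A D sigma gamma H1 H2 V G k
    + 2 * t * Q A D sigma gamma H1 H2 V G k i + t ^+ 2 * Kstate_coef2 G i k.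
Proof.
move=> ik; rewrite !Kstate_qform Q_qform//.
have -> := eq_qform r1 (fun l => @signal_coef_shift G i t k l ik).
have -> := eq_qform r2 (fun l => @obs_coef_shift G i t k l ik).
rewrite !qform_shift; try by move=> *; rewrite rho_distC.
by rewrite Hprod_shift_in// /Kstate_coef2; ring.
Qed.

(** The error covariance at time [k] involves only entries below [k], so the times [k <= i]
    contribute no change and the sums start at [i.+1]. *)
Lemma Jcost_shift N a G i t : (i < N)%N ->
  Jcost A D sigma gamma H1 H2 V N a (shift_ctl G i t)
  = Jcost A D sigma gamma H1 H2 V N a G
    + 2 * t * (\sum_(i.+1 <= k < N.+1) a k * Q A D sigma gamma H1 H2 V G k i)
    + t ^+ 2 * (\sum_(i.+1 <= k < N.+1) a k * Kstate_coef2 G i k).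
Proof.
move=> iN; have splitN (f : nat -> R) : \sum_(0 <= k < N.+1) f k =
    \sum_(0 <= k < i.+1) f k + \sum_(i.+1 <= k < N.+1) f k.
  by rewrite -big_cat_nat//= ltnW.
rewrite /Jcost !splitN.
under eq_big_nat => k do [move=> /= ki; rewrite Kstate_shift_notin//].
rewrite -!addrA; congr (_ + _).
rewrite !big_distrr/= -!big_split/=; apply: eq_big_nat => k /andP[ik _].
by rewrite Kstate_shift_in//; ring.
Qed.

Lemma Jcost_stationary N a G i : (i < N)%N ->
  (forall t, Jcost A D sigma gamma H1 H2 V N a G <=
             Jcost A D sigma gamma H1 H2 V N a (shift_ctl G i t)) ->
  \sum_(i.+1 <= k < N.+1) a k * Q A D sigma gamma H1 H2 V G k i = 0.
Proof.
move=> iN Gmin.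
apply: (@linear_coef_eq0 _ _ (\sum_(i.+1 <= k < N.+1) a k * Kstate_coef2 G i k)).
by move=> t; have := Gmin t; rewrite Jcost_shift// -addrA lerDl.
Qed.

End state_equation.

(** Brings the perturbed sequence back among the row vectors over which minimality is assumed. The
    bound on [i] matters because [ctl] is 0 from [N] on. *)
Lemma ctl_shift {R : realType} N (G : 'rV[R]_N) i t : (i < N)%N ->
  exists G' : 'rV[R]_N, ctl G' = shift_ctl (ctl G) i t.
Proof.
move=> iN; exists (\row_j shift_ctl (ctl G) i t j).
apply/funext => k; rewrite [LHS]/ctl; case: insubP => [j _ <-|].
  by rewrite mxE.
move=> kN; rewrite /shift_ctl /ctl insubN// (_ : k == i = false) ?mul0r ?addr0//.
by apply: contraNF kN => /eqP ->.
Qed.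

(** * Product rule for expectations under independence *)

Section uncorrelated.
Context d {T : measurableType d} {R : realType} (P : probability T R).

(** Independence says that the joint law of [X] and [Y] is the product of their laws; Fubini then
    factors the integral. *)
Lemma indep_expectation_comp d1 d2 (T1 : measurableType d1)
    (T2 : measurableType d2) (X : {RV P >-> T1}) (Y : {RV P >-> T2})
    (g : T1 -> R) (h : T2 -> R) :
  measurable_fun setT g -> measurable_fun setT h ->
  g \o X \in Lfun P 1 -> h \o Y \in Lfun P 1 ->
  (g \o X) \* (h \o Y) \in Lfun P 1 ->
  (forall S U, measurable S -> measurable U ->
     P (X @^-1` S `&` Y @^-1` U) = (P (X @^-1` S) * P (Y @^-1` U))%E) ->
  'E_P[(g \o X) \* (h \o Y)]%E = ('E_P[g \o X] * 'E_P[h \o Y])%E.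
Proof.
move=> mg mh /Lfun1_integrable iX /Lfun1_integrable iY /Lfun1_integrable iXY.
move=> XY.
pose Z w := (X w, Y w).
have mZ : measurable_fun setT Z by exact: measurable_fun_pair.
pose ZM := isMeasurableFun.Build _ _ _ _ Z mZ.
pose Zm : {RV P >-> (T1 * T2)%type} := HB.pack Z ZM.
pose f : T1 * T2 -> \bar R := EFin \o ((g \o fst) \* (h \o snd)).
have mf : measurable_fun [set: T1 * T2] f.
  by apply/measurable_EFinP; apply: measurable_funM; exact: measurableT_comp.
(* A product measure is determined by its values on rectangles, which independence provides for the
   joint law. *)
have prodE A : measurable A ->
    (distribution P X \x distribution P Y)%E A = distribution P Zm A.
  apply: product_measure_unique => S U mS mU.
  by rewrite /= /distribution /pushforward -XY.
have ifZ : (distribution P Zm).-integrable setT f.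
  exact: integrable_pushforward.
have ifXY : (distribution P X \x distribution P Y)%E.-integrable setT f.
  apply/integrableP; split => //.
  move/integrableP: ifZ => [_]; congr (_ < _)%E.
  by apply: eq_measure_integral => A mA _; rewrite [RHS]prodE.
have iX' : (distribution P X).-integrable setT (EFin \o g).
  by apply: integrable_pushforward => //; exact/measurable_EFinP.
have iY' : (distribution P Y).-integrable setT (EFin \o h).
  by apply: integrable_pushforward => //; exact/measurable_EFinP.
have EX : (\int[distribution P X]_x (g x)%:E = 'E_P[g \o X])%E.
  by rewrite unlock integral_distribution//; exact/measurable_EFinP.
have EY : (\int[distribution P Y]_x (h x)%:E = 'E_P[h \o Y])%E.
  by rewrite unlock integral_distribution//; exact/measurable_EFinP.
transitivity (\int[distribution P Zm]_z f z)%E.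
  by rewrite integral_distribution// unlock.
transitivity (\int[distribution P X \x distribution P Y]_z f z)%E.
  by apply: eq_measure_integral => A mA _; rewrite [RHS]prodE.
rewrite -integral12_prod_meas1// -EX -EY /fubini_F.
(* Finiteness allows the integral of [h] to be moved in and out of the outer integral as a real
   constant. *)
have iYfin : (\int[distribution P Y]_y (h y)%:E)%E \is a fin_num.
  exact: integrable_fin_num.
rewrite -(fineK iYfin) -integralZr//.
apply: eq_integral => x _; rewrite /f /=.
under eq_integral do rewrite EFinM.
by rewrite integralZl// fineK.
Qed.

(** Square integrability gives all three integrability conditions: for the factors because [P] is
    finite, for the product by the Hölder inequality. *)
Lemma indep_expectationM (X Y : {RV P >-> R}) :
  (X : T -> R) \in Lfun P 2%:E -> (Y : T -> R) \in Lfun P 2%:E ->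
  (forall S U, measurable S -> measurable U ->
     P (X @^-1` S `&` Y @^-1` U) = (P (X @^-1` S) * P (Y @^-1` U))%E) ->
  'E_P[X \* Y]%E = ('E_P[X] * 'E_P[Y])%E.
Proof.
move=> X2 Y2 XY.
have Pfin : P [set: T] \is a fin_num by rewrite fin_num_measure.
apply: (@indep_expectation_comp _ _ _ _ X Y idfun idfun) => //; try exact: measurable_id.
- exact: (Lfun_subset12 Pfin X2).
- exact: (Lfun_subset12 Pfin Y2).
- exact: Lfun2_mul_Lfun1.
Qed.

End uncorrelated.

(** * The inner product of square-integrable random variables *)

Section L2_inner_product.
Context d {T : measurableType d} {R : realType} (P : probability T R).
Local Notation L2 := (Lfun P 2%:E).
Implicit Types (X Y Z : T -> R).

(** Real-valued, so that ring identities apply. As [fine] sends infinite values to 0, the linearity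
    rules below ask for membership in [L2], where [L2_dot] guarantees finiteness. *)
Definition dot X Y : R := fine 'E_P[X \* Y]%E.

Lemma L2_dot X Y : X \in L2 -> Y \in L2 -> 'E_P[X \* Y]%E = (dot X Y)%:E.
Proof.
by move=> X2 Y2; rewrite /dot fineK// expectation_fin_num// Lfun2_mul_Lfun1.
Qed.

Lemma dotC X Y : dot X Y = dot Y X.
Proof. by congr (fine _); congr expectation; apply/funext => w /=; rewrite mulrC. Qed.

Lemma L2_expectation_sqr_lty X : measurable_fun setT X ->
  ('E_P[X \* X] < +oo)%E -> X \in L2.
Proof.
move=> mX EX; rewrite inE; apply/andP; split; rewrite inE//=.
rewrite /finite_norm unlock /Lnorm poweR_lty//=.
apply: le_lt_trans EX; rewrite unlock.
rewrite le_eqVlt; apply/orP; left; apply/eqP; apply: eq_integral => w _ /=.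
by rewrite powR_mulrn// real_normK ?num_real// expr2.
Qed.

Lemma L2D X Y : X \in L2 -> Y \in L2 -> X \+ Y \in L2.
Proof. by move=> X2 Y2; rewrite rpredD ?lee1n. Qed.

Lemma L2Z c X : X \in L2 -> (fun w => c * X w) \in L2.
Proof.
move=> X2; rewrite (_ : (fun w => c * X w) = c \o* X).
  by apply: Lfun_scale => //; rewrite ler1n.
by apply/funext => w /=; rewrite mulrC.
Qed.

Lemma L2B X Y : X \in L2 -> Y \in L2 -> X \- Y \in L2.
Proof. by move=> X2 Y2; rewrite rpredB ?lee1n. Qed.

Lemma dotDl X Y Z : X \in L2 -> Y \in L2 -> Z \in L2 ->
  dot (X \+ Y) Z = dot X Z + dot Y Z.
Proof.
move=> X2 Y2 Z2; apply: EFin_inj; rewrite EFinD -!L2_dot ?L2D//.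
rewrite -expectationD ?Lfun2_mul_Lfun1//; congr expectation.
by apply/funext => w /=; rewrite mulrDl.
Qed.

Lemma dotZl c X Y : X \in L2 -> Y \in L2 ->
  dot (fun w => c * X w) Y = c * dot X Y.
Proof.
move=> X2 Y2; apply: EFin_inj; rewrite EFinM -!L2_dot ?L2Z//.
rewrite -expectationZl ?Lfun2_mul_Lfun1//; congr expectation.
by apply/funext => w /=; rewrite [RHS]mulrC mulrA.
Qed.

Lemma dotBl X Y Z : X \in L2 -> Y \in L2 -> Z \in L2 ->
  dot (X \- Y) Z = dot X Z - dot Y Z.
Proof.
move=> X2 Y2 Z2; have -> : X \- Y = X \+ (fun w => -1 * Y w).
  by apply/funext => w /=; rewrite mulN1r.
by rewrite dotDl ?L2Z// dotZl// mulN1r.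
Qed.

Definition lin_comb k (u : nat -> R) (W : nat -> T -> R) : T -> R :=
  fun w => \sum_(0 <= i < k) u i * W i w.

Lemma lin_combS k u W :
  lin_comb k.+1 u W = lin_comb k u W \+ (fun w => u k * W k w).
Proof. by apply/funext => w; rewrite /lin_comb big_nat_recr. Qed.

Lemma lin_comb_L2 k u W : (forall i, W i \in L2) -> lin_comb k u W \in L2.
Proof.
move=> W2; elim: k => [|k IH]; last by rewrite lin_combS L2D// L2Z.
rewrite (_ : lin_comb 0 u W = cst 0) ?Lfun_cst//.
by apply/funext => w; rewrite /lin_comb big_nil.
Qed.

Lemma dot_lin_combl k u W X : (forall i, W i \in L2) -> X \in L2 ->
  dot (lin_comb k u W) X = \sum_(0 <= i < k) u i * dot (W i) X.
Proof.
move=> W2 X2; elim: k => [|k IH].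
  rewrite big_nil; have -> : lin_comb 0 u W = fun w => 0 * X w.
    by apply/funext => w; rewrite mul0r /lin_comb big_nil.
  by rewrite dotZl// mul0r.
by rewrite lin_combS dotDl ?lin_comb_L2 ?L2Z// dotZl// IH big_nat_recr.
Qed.

Lemma dot_lin_comb_eq0 k u W X : (forall i, W i \in L2) -> X \in L2 ->
  (forall i, dot (W i) X = 0) -> dot (lin_comb k u W) X = 0.
Proof.
move=> W2 X2 WX; rewrite dot_lin_combl// big1// => i _.
by rewrite WX mulr0.
Qed.

(** Links probability to algebra: [r] is the Gram matrix of the noises, and [qform] is the second
    moment of their combination. *)
Lemma dot_lin_comb_qform k u W (r : nat -> nat -> R) : (forall i, W i \in L2) ->
  (forall i j, dot (W i) (W j) = r i j) ->
  dot (lin_comb k u W) (lin_comb k u W) = qform r k u u.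
Proof.
move=> W2 Wr; rewrite dot_lin_combl ?lin_comb_L2//.
apply: eq_bigr => i _; rewrite dotC dot_lin_combl// big_distrr/=.
by apply: eq_bigr => j _; rewrite dotC Wr; ring.
Qed.

(** Pythagoras: all cross terms vanish. *)
Lemma dot_orthogonal3 X Y Z : X \in L2 -> Y \in L2 -> Z \in L2 ->
  dot X Y = 0 -> dot X Z = 0 -> dot Y Z = 0 ->
  dot (X \+ (Y \+ Z)) (X \+ (Y \+ Z)) = dot X X + dot Y Y + dot Z Z.
Proof.
move=> X2 Y2 Z2 XY XZ YZ.
have dotSl W : W \in L2 -> dot (X \+ (Y \+ Z)) W = dot X W + dot Y W + dot Z W.
  by move=> W2; rewrite dotDl ?L2D// dotDl// addrA.
rewrite dotSl ?L2D ?L2D// [dot X _]dotC [dot Y _]dotC [dot Z _]dotC !dotSl//.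
rewrite (dotC Y X) (dotC Z X) (dotC Z Y) XY XZ YZ; ring.
Qed.

End L2_inner_product.

(** * Second moments of fractional Brownian increments *)

Section fbm_increments.
Context d {T : measurableType d} {R : realType} (P : probability T R).
Local Notation L2 := (Lfun P 2%:E).

(** The covariance formula at equal times makes the second moment a real number, hence finite. *)
Lemma fbm_L2 (H : R) (B : R -> {RV P >-> R}) t :
  is_fbm H B -> 0 <= t -> (B t : T -> R) \in L2.
Proof.
move=> [_ _ _ covB] t0; apply: L2_expectation_sqr_lty => //.
by have := covB t t t0 t0; rewrite /= => ->; rewrite ltry.
Qed.

Lemma increment_L2 H (B : R -> {RV P >-> R}) k :
  is_fbm H B -> increment B k \in L2.
Proof. by move=> fB; apply: L2B; apply: fbm_L2 fB _. Qed.

Lemma dot_fbm H (B : R -> {RV P >-> R}) s t :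
  is_fbm H B -> 0 <= s -> 0 <= t ->
  dot P (B t) (B s) = 2^-1 * (t `^ (2 * H) + s `^ (2 * H) - `|t - s| `^ (2 * H)).
Proof. by move=> [_ _ _ covB] s0 t0; rewrite /dot [X in fine X]covB. Qed.

(** Bilinearity gives four covariances. The powers of single times cancel and those of the time
    differences remain. *)
Lemma dot_increment H (B : R -> {RV P >-> R}) i j : is_fbm H B ->
  dot P (increment B i) (increment B j) = rho H (i%:Z - j%:Z).
Proof.
move=> fB; have B2 (n : nat) : (B n%:R : T -> R) \in L2 by exact: fbm_L2 fB _.
have incE n : increment B n = (B n.+1%:R : T -> R) \- (B n%:R : T -> R) by [].
rewrite !incE dotBl ?L2B// !(dotC _ _ (_ \- _)) !dotBl//.
rewrite !(dot_fbm fB)// /rho.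
(* The integer arguments of [rho] are rewritten as negatives of the time differences in the
   expansion; absolute values absorb the sign. *)
have -> : (i%:Z - j%:Z + 1)%:~R = - (j%:R - i.+1%:R) :> R.
  by rewrite intrD intrB -!pmulrn -natr1; ring.
have -> : (i%:Z - j%:Z - 1)%:~R = - (j.+1%:R - i%:R) :> R.
  by rewrite !intrB -!pmulrn -natr1; ring.
have -> : (i%:Z - j%:Z)%:~R = - (j%:R - i%:R) :> R.
  by rewrite intrB -!pmulrn; ring.
have -> : j.+1%:R - i.+1%:R = j%:R - i%:R :> R by rewrite -!natr1; ring.
rewrite !normrN; ring.
Qed.

(* Independence is applied to the values of the processes, not to their
   increments: a preimage under a single value is a generator of
   [sigma_family]. *)
Lemma indep_dot_fbm_eq0 HA HB (BA BB : R -> {RV P >-> R}) s t :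
  is_fbm HA BA -> is_fbm HB BB -> indep_processes BA BB ->
  0 <= s -> 0 <= t -> dot P (BA s) (BB t) = 0.
Proof.
move=> fA fB iAB s0 t0; have [_ _ mA _] := fA.
rewrite /dot indep_expectationM; [|exact: fbm_L2 fA s0|exact: fbm_L2 fB t0|].
  by rewrite mA// mul0e.
move=> S U mS mU; apply: iAB; apply: sub_gen_smallest.
  by exists s => //; exists S => //; rewrite setTI.
by exists t => //; exists U => //; rewrite setTI.
Qed.

Lemma dot_increments_eq0 HA HB (BA BB : R -> {RV P >-> R}) i j :
  is_fbm HA BA -> is_fbm HB BB -> indep_processes BA BB ->
  dot P (increment BA i) (increment BB j) = 0.
Proof.
move=> fA fB iAB.
have A2 (n : nat) : (BA n%:R : T -> R) \in L2 by exact: fbm_L2 fA _.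
have B2 (n : nat) : (BB n%:R : T -> R) \in L2 by exact: fbm_L2 fB _.
have AB0 (m n : nat) : dot P (BB m%:R) (BA n%:R) = 0.
  by rewrite dotC (indep_dot_fbm_eq0 fA fB).
have -> : increment BA i = (BA i.+1%:R : T -> R) \- (BA i%:R : T -> R) by [].
have -> : increment BB j = (BB j.+1%:R : T -> R) \- (BB j%:R : T -> R) by [].
by rewrite dotBl ?L2B// !(dotC _ _ (_ \- _)) !dotBl// !AB0 !subr0.
Qed.

Lemma expectation_increment H (B : R -> {RV P >-> R}) k :
  is_fbm H B -> 'E_P[increment B k]%E = 0%E.
Proof.
move=> fB; have Pfin : P [set: T] \is a fin_num by rewrite fin_num_measure.
have [_ _ mB _] := fB.
have -> : increment B k = (B k.+1%:R : T -> R) \- (B k%:R : T -> R) by [].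
have B1 (n : nat) : (B n%:R : T -> R) \in Lfun P 1.
  by apply: (Lfun_subset12 Pfin); exact: fbm_L2 fB _.
by rewrite expectationB// !mB// sube0.
Qed.

(** The increment has mean 0, so it is orthogonal to every constant and, by independence, to
    [x0]. *)
Lemma dot_centered_increment_eq0 H (B : R -> {RV P >-> R}) (x0 : {RV P >-> R})
    (m : R) k :
  is_fbm H B -> (x0 : T -> R) \in L2 ->
  (forall S U, measurable S -> measurable U ->
    P (x0 @^-1` S `&` increment B k @^-1` U)
    = (P (x0 @^-1` S) * P (increment B k @^-1` U))%E) ->
  dot P (fun w => x0 w - m) (increment B k) = 0.
Proof.
move=> fB x02 ind; have W2 := increment_L2 k fB.
have mW : measurable_fun setT (increment B k) by exact: measurable_funB.
(* The increment is a bare function; it is packed as a random variable so that the product rule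
   applies. *)
pose WM := isMeasurableFun.Build _ _ _ _ (increment B k) mW.
pose W : {RV P >-> R} := HB.pack (increment B k) WM.
have -> : (fun w => x0 w - m) = (x0 : T -> R) \- cst m by [].
rewrite dotBl ?Lfun_cst// {1}/dot (@indep_expectationM _ _ _ P x0 W)//.
have -> : cst m = (fun w : T => m * cst 1 w).
  by apply/funext => w; rewrite /= mulr1.
rewrite dotZl ?Lfun_cst// /dot.
rewrite (_ : cst 1 \* increment B k = increment B k).
  by rewrite (expectation_increment k fB) mule0 mulr0 subr0.
by apply/funext => w; rewrite /= mul1r.
Qed.

End fbm_increments.

(** * The filtering error and its mean square *)

Section filtering_error.
Context {T : Type} {R : realType}.
Variables (N : nat) (A C sigma D F gamma : nat -> R).

Lemma filter_error_step (W1 W2 : nat -> T -> R) (x0 : T -> R)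
    (x y : nat -> T -> R) (G : nat -> R) (m : R) (z : nat -> T -> R) k w :
  signal_observation N A C sigma D F gamma W1 W2 x0 x y ->
  is_filter N A C D F m y G z -> (k < N)%N ->
  x k.+1 w - z k.+1 w = Hcoef A D G k * (x k w - z k w)
    + sigma k * W1 k w - G k * gamma k * W2 k w.
Proof.
move=> [xS yS _ _] [zS _] kN; rewrite zS// xS// yS// /Hcoef; ring.
Qed.

End filtering_error.

Section mean_square_error.
Context d {T : measurableType d} {R : realType} (P : probability T R).
Variables (N : nat) (A C sigma D F gamma : nat -> R) (H1 H2 : R).
Variables (B1 B2 : R -> {RV P >-> R}) (x0 : {RV P >-> R}).
Hypotheses (H1_neq0 : H1 != 0) (H2_neq0 : H2 != 0).
Hypotheses (B1_fbm : is_fbm H1 B1) (B2_fbm : is_fbm H2 B2).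
Hypotheses (B_indep : indep_processes B1 B2).
Hypotheses (x0_L2 : (x0 : T -> R) \in Lfun P 2%:E).
Hypotheses (x0_indep : indep_of_noises P x0 (increment B1) (increment B2)).
Variables (x y : nat -> T -> R).
Hypotheses (xy_system : signal_observation N A C sigma D F gamma
                          (increment B1) (increment B2) x0 x y).

Local Notation m0 := (fine 'E_P[x0]%E).
Local Notation V0 := (fine (variance P x0)).

(** Induction on [k]: multiplication by [Hcoef A D G k] carries every old coefficient from time [k]
    to [k.+1], while the newest noises enter with an empty product. *)
Lemma filter_errorE (G : nat -> R) (z : nat -> T -> R) k :
  is_filter N A C D F m0 y G z -> (k <= N)%N ->
  (fun w => x k w - z k w) =
  (fun w => Hprod A D G k 0 * (x0 w - m0)) \+
  (lin_comb k (signal_coef A D sigma G k) (increment B1) \+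
   lin_comb k (fun l => - obs_coef A D gamma G k l) (increment B2)).
Proof.
move=> zG; elim: k => [_|k IH kN]; apply/funext => w.
  have [_ _ xE _] := xy_system; have [_ zE] := zG.
  by rewrite /= xE zE Hprod_id /lin_comb !big_nil mul1r !addr0.
rewrite (filter_error_step w xy_system zG kN).
have := congr1 (fun f => f w) (IH (ltnW kN)); rewrite /= => ->.
have sk : signal_coef A D sigma G k.+1 k = sigma k.
  by rewrite /signal_coef Hprod_id mul1r.
have ok : obs_coef A D gamma G k.+1 k = G k * gamma k.
  by rewrite /obs_coef Hprod_id mul1r.
rewrite !lin_combS /= sk ok Hprod_recr//.
have -> : lin_comb k (signal_coef A D sigma G k.+1) (increment B1) w
    = Hcoef A D G k * lin_comb k (signal_coef A D sigma G k) (increment B1) w.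
  rewrite /lin_comb big_distrr/=; apply: eq_big_nat => l /= lk.
  by rewrite /signal_coef Hprod_recr//; ring.
have -> : lin_comb k (fun l => - obs_coef A D gamma G k.+1 l) (increment B2) w
    = Hcoef A D G k
      * lin_comb k (fun l => - obs_coef A D gamma G k l) (increment B2) w.
  rewrite /lin_comb big_distrr/=; apply: eq_big_nat => l /= lk.
  by rewrite /obs_coef Hprod_recr//; ring.
ring.
Qed.

Lemma mean_square_error (G : nat -> R) (z : nat -> T -> R) k :
  is_filter N A C D F m0 y G z -> (k <= N)%N ->
  'E_P[fun w => (`|x k w - z k w| ^+ 2)%R]%E =
  (Kstate A D sigma gamma H1 H2 V0 G k)%:E.
Proof.
move=> zG kN; have W1L2 i := increment_L2 i B1_fbm.
have W2L2 i := increment_L2 i B2_fbm.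
pose X0 w := x0 w - m0.
have X0L2 : X0 \in Lfun P 2%:E.
  have -> : X0 = (x0 : T -> R) \- cst m0 by [].
  by rewrite L2B ?Lfun_cst.
(* A preimage under one increment generates the sigma-algebra of its own noise, which in turn is one
   of the two generating families of the joint one. *)
have X0W1 i : dot P X0 (increment B1 i) = 0.
  apply: (dot_centered_increment_eq0 _ B1_fbm) => // S U mS mU; apply: x0_indep.
    by apply: sub_gen_smallest; exists tt => //; exists S => //; rewrite setTI.
  apply: sub_gen_smallest; left; apply: sub_gen_smallest.
  by exists i => //; exists U => //; rewrite setTI.
have X0W2 i : dot P X0 (increment B2 i) = 0.
  apply: (dot_centered_increment_eq0 _ B2_fbm) => // S U mS mU; apply: x0_indep.
    by apply: sub_gen_smallest; exists tt => //; exists S => //; rewrite setTI.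
  apply: sub_gen_smallest; right; apply: sub_gen_smallest.
  by exists i => //; exists U => //; rewrite setTI.
have W1W2 i j : dot P (increment B1 i) (increment B2 j) = 0.
  exact: (dot_increments_eq0 _ _ B1_fbm B2_fbm).
pose e w := x k w - z k w.
have eE := filter_errorE zG kN; rewrite -/e in eE.
have eL2 : e \in Lfun P 2%:E by rewrite eE !L2D ?lin_comb_L2 ?L2Z.
have -> : (fun w => `|x k w - z k w| ^+ 2) = e \* e.
  by apply/funext => w; rewrite real_normK ?num_real// expr2.
rewrite L2_dot//; congr EFin; rewrite Kstate_qform// eE dot_orthogonal3.
- congr (_ + _ + _).
  (* The remaining factor is the second moment of [x0] centered at its mean, which is the variance
     by definition. *)
  + rewrite dotZl ?L2Z// dotC dotZl// mulrA -expr2; congr (_ * _).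
    by rewrite /variance covariance.unlock.
  + by apply: dot_lin_comb_qform => // i j; exact: dot_increment.
  (* The coefficients are minus [obs_coef]; the two signs cancel in each product. *)
  + rewrite (@dot_lin_comb_qform _ _ _ P k _ _
      (fun i j => rho H2 (i%:Z - j%:Z)))//.
      rewrite /qform; apply: eq_bigr => i _; apply: eq_bigr => j _; ring.
    by move=> i j; exact: dot_increment.
- by rewrite L2Z.
- by rewrite lin_comb_L2.
- by rewrite lin_comb_L2.
- rewrite dotZl ?lin_comb_L2// dotC dot_lin_comb_eq0 ?mulr0// => i.
  by rewrite dotC.
- rewrite dotZl ?lin_comb_L2// dotC dot_lin_comb_eq0 ?mulr0// => i.
  by rewrite dotC.
- rewrite dot_lin_comb_eq0 ?lin_comb_L2// => i.
  by rewrite dotC dot_lin_comb_eq0// => j; rewrite dotC.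
Qed.

Lemma mse_costE (a : nat -> R) (G : nat -> R) (z : nat -> T -> R) :
  is_filter N A C D F m0 y G z ->
  mse_cost P N a x z = (Jcost A D sigma gamma H1 H2 V0 N a G)%:E.
Proof.
move=> zG; rewrite /mse_cost /Jcost -sumEFin; apply: eq_big_nat => k /= kN.
by rewrite (mean_square_error zG).
Qed.

End mean_square_error.

(** * Stationarity of the optimal control and optimality of its filter *)

Theorem theorem2 (R : realType) (d : measure_display) (T : measurableType d)
  (P : probability T R) (N : nat) (N_ge1 : (1 <= N)%N)
  (A C sigma D F gamma a : nat -> R)
  (a_ge0 : forall k, (k <= N)%N -> 0 <= a k)
  (H1 H2 : R) (H1_gt : 2^-1 < H1) (H1_lt : H1 < 1)
  (H2_gt : 2^-1 < H2) (H2_lt : H2 < 1)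
  (B1 B2 : R -> {RV P >-> R})
  (B1_fbm : is_fbm H1 B1) (B2_fbm : is_fbm H2 B2)
  (B_indep : indep_processes B1 B2)
  (x0 : {RV P >-> R}) (x0_L2 : (x0 : T -> R) \in Lfun P 2%:E)
  (x0_indep : indep_of_noises P x0 (increment B1) (increment B2))
  (x y : nat -> T -> R)
  (xy_system : signal_observation N A C sigma D F gamma
                 (increment B1) (increment B2) x0 x y)
  (Gamma0 : 'rV[R]_N)
  (Gamma0_opt : forall Gamma : 'rV[R]_N,
     Jcost A D sigma gamma H1 H2 (fine (variance P x0)) N a (ctl Gamma0) <=
     Jcost A D sigma gamma H1 H2 (fine (variance P x0)) N a (ctl Gamma)) :
  (forall i : nat, (i < N)%N ->
     \sum_(i.+1 <= k < N.+1)
       a k * Q A D sigma gamma H1 H2 (fine (variance P x0)) (ctl Gamma0) k i = 0) /\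
  (forall z0 : nat -> T -> R,
     (forall k, (k < N)%N -> forall w,
        z0 k.+1 w = (A k - ctl Gamma0 k * D k) * z0 k w
                    + (C k - ctl Gamma0 k * F k) * y k w
                    + ctl Gamma0 k * y k.+1 w) ->
     (forall w, z0 0%N w = fine 'E_P[x0]%E) ->
     optimal_filter P N A C D F a (fine 'E_P[x0]%E) x y z0).
Proof.
have half_gt0 : 0 < 2^-1 :> R by rewrite invr_gt0.
have H1_neq0 : H1 != 0 by rewrite gt_eqF// (lt_trans half_gt0).
have H2_neq0 : H2 != 0 by rewrite gt_eqF// (lt_trans half_gt0).
split=> [i iN|z0 z0S z00].
  apply: Jcost_stationary => // t.
  (* The perturbed control is again a row vector, so minimality of [Gamma0] compares with it. *)
  by have [G' <-] := ctl_shift Gamma0 t iN; exact: Gamma0_opt.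
split; first by exists Gamma0.
(* Both filtering costs are real values of [Jcost], so their comparison is again the minimality of
   [Gamma0]. *)
have mseE := mse_costE H1_neq0 H2_neq0 B1_fbm B2_fbm B_indep x0_L2 x0_indep
  xy_system a.
by move=> G z' z'G; rewrite !(mseE (ctl Gamma0) z0, mseE (ctl G) z')// lee_fin.
Qed.
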